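(* Let $\mathbf G$ be a finite abelian group. Let $\mathrm{MinQVar}(\mathbf G)$ be the set of minimal quasivarieties of $\mathbf G$-semilattices and $\mathrm{Sub}(\mathbf G)$ the set of subgroups of $\mathbf G$. For $\mathcal R\in\mathrm{MinQVar}(\mathbf G)$ let $H_{\mathcal R}=\{g\in G: g(a)=a\}$, where $a$ is the free generator of the one-generated free algebra $\mathbf F_{\mathcal R}(a)$ of $\mathcal R$. Then the map $\alpha\colon\mathcal R\mapsto H_{\mathcal R}$ is a bijection from $\mathrm{MinQVar}(\mathbf G)$ to $\mathrm{Sub}(\mathbf G)$. The inverse map $\beta\colon\mathrm{Sub}(\mathbf G)\to\mathrm{MinQVar}(\mathbf G)$ is defined by $H\mapsto\mathcal Q\bigl(\mathbf M(H,\mathbf G)\bigr)$.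
   Context: Let $\mathbf G=\langle G;\cdot,\mathrm{id}\rangle$ be an abelian group. A $\mathbf G$-semilattice is an algebra $\mathbf A=\langle A;\wedge,G\rangle$ with a binary operation $\wedge$ and each $g\in G$ acting as a unary operation on $A$, such that: $\wedge$ is associative, idempotent and commutative; $\mathrm{id}(x)=x$; $f(g(x))=(f\cdot g)(x)$ for all $f,g\in G$; and $g(x)\wedge g(y)=g(x\wedge y)$ for all $g\in G$. $\mathbf A$ is trivial if $|A|=1$. A quasi-identity is a universally quantified sentence $(p_1\approx q_1\ \&\cdots\&\ p_n\approx q_n)\Rightarrow p\approx q$ with $n\ge 0$ and $p_i,q_i,p,q$ terms. A quasivariety is a class of similar algebras defined by quasi-identities; $\mathcal Q(\mathbf A)$ is the least quasivariety containing $\mathbf A$. A quasivariety is trivial if it consists of trivial algebras. A nontrivial quasivariety is minimal if its only proper subquasivariety is the trivial one. $\mathbf F_{\mathcal R}(a)$ denotes the free algebra of $\mathcal R$ freely generated by the single element $a$. For a subgroup $H$ of $\mathbf G$, $\mathbf M(H,\mathbf G)=\langle M(H,\mathbf G);\cap,G\rangle$ is the $\mathbf G$-semilattice with underlying set $M(H,\mathbf G)=\{\emptyset\}\cup\{gH:g\in G\}$, with $\cap$ the usual intersection and $f(gH)=fgH$, $f(\emptyset)=\emptyset$ for $f,g\in G$. *)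

(* Defs.v *)
From Stdlib Require List.
From HB Require Import structures.
From mathcomp Require Import all_boot all_fingroup generic_quotient.
From mathcomp Require Import boolp.

Set Implicit Arguments.
Unset Strict Implicit.
Unset Printing Implicit Defensive.

Local Open Scope group_scope.
Local Open Scope quotient_scope.

(* The group G is the whole type gT. As usual in universal algebra, carriers
   are nonempty. *)
Record gslat (gT : finGroupType) := GSlat {
  gcarrier :> Type;
  gmeet : gcarrier -> gcarrier -> gcarrier;
  gact : gT -> gcarrier -> gcarrier;
  _ : inhabited gcarrier;
  gmeetA : associative gmeet;
  gmeetxx : idempotent_op gmeet;
  gmeetC : commutative gmeet;
  gact1 : forall x, gact 1 x = x;
  gactM : forall (f g : gT) x, gact f (gact g x) = gact (f * g) x;
  gactI : forall g x y, gmeet (gact g x) (gact g y) = gact g (gmeet x y)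
}.

Definition trivial_gslat (gT : finGroupType) (A : gslat gT) : Prop :=
  exists a : A, forall x : A, x = a.

Inductive term (gT : finGroupType) (X : Type) : Type :=
| Var of X
| Meet of term gT X & term gT X
| Act of gT & term gT X.

Fixpoint eval (gT : finGroupType) (X : Type) (A : gslat gT) (v : X -> A)
    (t : term gT X) : A :=
  match t with
  | Var x => v x
  | Meet s u => gmeet (eval v s) (eval v u)
  | Act g s => gact g (eval v s)
  end.

Record quasi_identity (gT : finGroupType) := QuasiIdentity {
  premises : seq (term gT nat * term gT nat);
  conclusion : term gT nat * term gT nat
}.

Definition satisfies (gT : finGroupType) (A : gslat gT)
    (q : quasi_identity gT) : Prop :=
  forall v : nat -> A,
    List.Forall (fun e => eval v e.1 = eval v e.2) (premises q) ->
    eval v (conclusion q).1 = eval v (conclusion q).2.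

(* Not [set (gslat gT)] of classical_sets: that universe lies below the
   one of gslat. *)
Definition gclass (gT : finGroupType) := gslat gT -> Prop.

(* The axioms of G-semilattices being identities, quasivarieties of
   G-semilattices are the classes of G-semilattices cut out by a set of
   quasi-identities. *)
Definition models (gT : finGroupType) (S : quasi_identity gT -> Prop) :
    gclass gT :=
  fun A => forall q, S q -> satisfies A q.

Definition quasivariety (gT : finGroupType) (R : gclass gT) : Prop :=
  exists S, R = models S.

Definition trivial_class (gT : finGroupType) (R : gclass gT) : Prop :=
  forall A, R A -> trivial_gslat A.

Definition minimal_quasivariety (gT : finGroupType) (R : gclass gT) : Prop :=
  [/\ quasivariety R, ~ trivial_class R
    & forall K, quasivariety K -> (forall A, K A -> R A) -> K <> R ->
        trivial_class K].

Definition MinQVar (gT : finGroupType) : Type :=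
  {R : gclass gT | minimal_quasivariety R}.

Definition Qgen (gT : finGroupType) (A : gslat gT) : gclass gT :=
  fun B => forall K, quasivariety K -> K A -> K B.

Lemma Qgen_quasivariety (gT : finGroupType) (A : gslat gT) :
  quasivariety (Qgen A).
Proof.
exists (satisfies A); apply/funext => B; apply/propext; split.
  by apply; [exists (satisfies A) | move=> q].
by move=> BS K [S ->] AK q Sq; apply: BS; exact: AK.
Qed.

(* The free algebra F_R(a): the terms in a single variable, modulo the
   identities valid in R. *)
Section FreeAlgebra.
Variables (gT : finGroupType) (R : gclass gT).

Definition term1 := term gT unit.
HB.instance Definition _ := gen_eqMixin term1.
HB.instance Definition _ := gen_choiceMixin term1.

Definition valid_in (s t : term1) : Prop :=
  forall A : gslat gT, R A -> forall v : unit -> A, eval v s = eval v t.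

Definition free_equiv : rel term1 := fun s t => `[< valid_in s t >].

Lemma free_equiv_refl : reflexive free_equiv.
Proof. by move=> t; apply/asboolP => A RA v. Qed.

Lemma free_equiv_sym : symmetric free_equiv.
Proof.
by move=> s t; apply/asboolP/asboolP => + A RA v => /(_ A RA v) ->.
Qed.

Lemma free_equiv_trans : transitive free_equiv.
Proof.
move=> t s u /asboolP st /asboolP tu; apply/asboolP => A RA v.
by rewrite st ?tu.
Qed.

Canonical free_equiv_rel :=
  EquivRel free_equiv free_equiv_refl free_equiv_sym free_equiv_trans.

Definition free_carrier := {eq_quot free_equiv_rel}.

Lemma free_eqP (s t : term1) :
  \pi_free_carrier s = \pi_free_carrier t <-> valid_in s t.
Proof.
split=> [/eqquotP/asboolP //|st]; apply/eqquotP; exact/asboolP.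
Qed.

Definition free_meet (x y : free_carrier) : free_carrier :=
  \pi_free_carrier (Meet (repr x) (repr y)).
Definition free_act (g : gT) (x : free_carrier) : free_carrier :=
  \pi_free_carrier (Act g (repr x)).

Lemma repr_valid (t : term1) : valid_in (repr (\pi_free_carrier t)) t.
Proof. by apply/free_eqP; rewrite reprK. Qed.

Lemma free_meetE s t :
  free_meet (\pi s) (\pi t) = \pi_free_carrier (Meet s t).
Proof. by apply/free_eqP => A RA v /=; rewrite !repr_valid. Qed.

Lemma free_actE g t : free_act g (\pi t) = \pi_free_carrier (Act g t).
Proof. by apply/free_eqP => A RA v /=; rewrite !repr_valid. Qed.

Lemma free_inh : inhabited free_carrier.
Proof. exact: (inhabits (\pi_free_carrier (Var gT tt))). Qed.

Lemma free_meetA : associative free_meet.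
Proof.
elim/quotW=> x; elim/quotW=> y; elim/quotW=> z; rewrite !free_meetE.
by apply/free_eqP => A RA v /=; rewrite gmeetA.
Qed.

Lemma free_meetxx : idempotent_op free_meet.
Proof.
elim/quotW=> x; rewrite free_meetE.
by apply/free_eqP => A RA v /=; rewrite gmeetxx.
Qed.

Lemma free_meetC : commutative free_meet.
Proof.
elim/quotW=> x; elim/quotW=> y; rewrite !free_meetE.
by apply/free_eqP => A RA v /=; rewrite gmeetC.
Qed.

Lemma free_act1 x : free_act 1 x = x.
Proof.
elim/quotW: x => x; rewrite free_actE.
by apply/free_eqP => A RA v /=; rewrite gact1.
Qed.

Lemma free_actM (f g : gT) x : free_act f (free_act g x) = free_act (f * g) x.
Proof.
elim/quotW: x => x; rewrite !free_actE.
by apply/free_eqP => A RA v /=; rewrite gactM.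
Qed.

Lemma free_actI g x y :
  free_meet (free_act g x) (free_act g y) = free_act g (free_meet x y).
Proof.
elim/quotW: x => x; elim/quotW: y => y.
rewrite !(free_actE, free_meetE).
by apply/free_eqP => A RA v /=; rewrite gactI.
Qed.

Definition free1 : gslat gT :=
  GSlat free_inh free_meetA free_meetxx free_meetC free_act1 free_actM
    free_actI.

Definition free1_gen : free1 := \pi_free_carrier (Var gT tt).

Lemma free1_eval (v : nat -> free1) (t : term gT nat) (A : gslat gT) :
    R A -> forall w : unit -> A,
  eval w (repr (eval v t : free_carrier))
  = eval (fun n => eval w (repr (v n : free_carrier))) t.
Proof.
move=> RA w; elim: t => [n|s IHs t IHt|g s IHs] //=.
  by rewrite repr_valid //= IHs IHt.
by rewrite repr_valid //= IHs.
Qed.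

Lemma free1_in : quasivariety R -> R free1.
Proof.
move=> [S RS]; rewrite [X in X _]RS => q Sq v prem.
suff: valid_in (repr (eval v (conclusion q).1 : free_carrier))
               (repr (eval v (conclusion q).2 : free_carrier)).
  by move=> /free_eqP; rewrite !reprK.
move=> A RA w; rewrite !free1_eval //.
have : models S A by rewrite -RS.
move=> /(_ q Sq); apply.
apply: List.Forall_impl prem => e /= eE.
by rewrite -!free1_eval // eE.
Qed.

Lemma free1_univ (B : gslat gT) (b : B) : R B ->
  exists! f : free1 -> B,
    [/\ f free1_gen = b,
        forall x y, f (gmeet x y) = gmeet (f x) (f y)
      & forall g x, f (gact g x) = gact g (f x)].
Proof.
move=> RB; exists (fun x : free_carrier => eval (fun=> b) (repr x)).
split; first split=> /=.
- by rewrite repr_valid.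
- by move=> x y; rewrite repr_valid.
- by move=> g x; rewrite repr_valid.
move=> f [fa fI fM]; apply/funext => x; elim/quotW: x => t.
rewrite repr_valid //; elim: t => [[]|s IHs t IHt|g s IHs] /=.
- by rewrite fa.
- by rewrite -free_meetE (fI (\pi s) (\pi t)) IHs IHt.
- by rewrite -free_actE (fM g (\pi s)) IHs.
Qed.

Definition gen_stab : {set gT} :=
  [set g : gT | `[< gact g free1_gen = free1_gen >]].

Lemma gen_stab_group_set : group_set gen_stab.
Proof.
apply/group_setP; split; first by rewrite inE; apply/asboolP; exact: gact1.
move=> f g; rewrite !inE => /asboolP fa /asboolP ga; apply/asboolP.
by rewrite -gactM ga fa.
Qed.

Canonical gen_stab_group : {group gT} := Group gen_stab_group_set.

End FreeAlgebra.

Definition alpha (gT : finGroupType) (R : MinQVar gT) : {group gT} :=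
  [group of gen_stab (sval R)].

Section CosetSemilattice.
Variables (gT : finGroupType) (H : {group gT}).

Definition is_M (X : {set gT}) : bool :=
  (X == set0) || (X \in lcosets H [set: gT]).

Definition M_carrier : Type := {X : {set gT} | is_M X}.

Lemma is_M_cap (X Y : M_carrier) : is_M (val X :&: val Y).
Proof.
case: X Y => [X /= /orP[/eqP->|/lcosetsP[x _ ->]]] [Y /= MY].
  by rewrite /is_M set0I eqxx.
case/orP: MY => [/eqP->|/lcosetsP[y _ ->]].
  by rewrite /is_M setI0 eqxx.
have [->|[z]] := set_0Vmem ((x *: H) :&: (y *: H)).
  by rewrite /is_M eqxx.
rewrite in_setI => /andP[/lcoset_eqP xz /lcoset_eqP yz].
rewrite /is_M; apply/orP; right.
by rewrite -xz -yz setIid; apply/lcosetsP; exists z; rewrite ?in_setT.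
Qed.

Lemma is_M_act (f : gT) (X : M_carrier) : is_M (f *: val X).
Proof.
case: X => [X /= /orP[/eqP->|/lcosetsP[x _ ->]]]; rewrite /is_M.
  by rewrite -lcosetE /lcoset imset0 eqxx.
rewrite -lcosetM; apply/orP; right; apply/lcosetsP.
by exists (f * x); rewrite ?in_setT.
Qed.

Definition M_cap (X Y : M_carrier) : M_carrier :=
  exist _ (val X :&: val Y) (is_M_cap X Y).
Definition M_act (f : gT) (X : M_carrier) : M_carrier :=
  exist _ (f *: val X) (is_M_act f X).

Lemma is_M0 : is_M (set0 : {set gT}).
Proof. by rewrite /is_M eqxx. Qed.

Lemma M_inh : inhabited M_carrier.
Proof. exact: (inhabits (exist _ set0 is_M0)). Qed.

Lemma M_capA : associative M_cap.
Proof. by move=> X Y Z; apply: val_inj; rewrite /= setIA. Qed.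

Lemma M_capxx : idempotent_op M_cap.
Proof. by move=> X; apply: val_inj; rewrite /= setIid. Qed.

Lemma M_capC : commutative M_cap.
Proof. by move=> X Y; apply: val_inj; rewrite /= setIC. Qed.

Lemma M_act1 X : M_act 1 X = X.
Proof. by apply: val_inj; rewrite /= mul1g. Qed.

Lemma M_actM (f g : gT) X : M_act f (M_act g X) = M_act (f * g) X.
Proof. by apply: val_inj; rewrite /= lcosetM. Qed.

Lemma M_actI f X Y : M_cap (M_act f X) (M_act f Y) = M_act f (M_cap X Y).
Proof.
apply: val_inj => /=; apply/setP => z.
by rewrite !(mem_lcoset, in_setI).
Qed.

Definition M : gslat gT :=
  GSlat M_inh M_capA M_capxx M_capC M_act1 M_actM M_actI.

End CosetSemilattice.

(* Main.v *)
From mathcomp Require Import all_boot all_fingroup.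
From mathcomp Require Import boolp.
Require Import Defs.

(** The coset semilattices [M L] are the atoms of the theory: every nontrivial
    quasivariety contains one of them, and, when [G] is abelian, the only one
    in [Qgen (M H)] is [M H].

    For the first claim ([nontrivial_quasivariety_M]), take a nontrivial
    member [A] of the quasivariety.  It has elements [z < x].  As [G] is
    finite, the meet [o] of the orbit of [z] exists; it is fixed by [G] and
    lies strictly below [x].  Among the meets of subsets of the orbit of [x],
    take one, [b], that differs from [o] and comes from a maximal subset.  A
    translate of [b] is then equal to [b] or meets it in [o], by maximality.
    So [o] and the translates of [b] form a copy of [M L] inside [A], where
    [L] is the stabilizer of [b], and quasivarieties are closed under
    subalgebras.

    For the second claim ([M_in_Qgen]), [H] can be read off the
    quasi-identities of [M H] when [G] is abelian: an element [g] of [H] gives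
    the identity [g x = x], and an element [g] outside [H] fixes only the empty
    set, which gives the quasi-identity [g x = x => x /\ y = x].

    Hence a nontrivial subquasivariety of [Qgen (M H)] contains [M H], so that
    [Qgen (M H)] is minimal.  Conversely a minimal quasivariety contains some
    [M L], hence is [Qgen (M L)].  The map [alpha] recovers [H] from
    [Qgen (M H)], since [g] fixes the free generator exactly when [g x = x] is
    an identity of the quasivariety. *)

Set Implicit Arguments.
Unset Strict Implicit.
Unset Printing Implicit Defensive.

Local Open Scope group_scope.

(** * Quasivarieties, embeddings and the stabilizer of the free generator *)

Section Quasivarieties.
Variable gT : finGroupType.
Implicit Types (A B : gslat gT) (R : gclass gT) (g : gT).

Lemma quasivariety_embedding R A B (f : B -> A) :
    injective f ->
    (forall x y, f (gmeet x y) = gmeet (f x) (f y)) ->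
    (forall g x, f (gact g x) = gact g (f x)) ->
  quasivariety R -> R A -> R B.
Proof.
move=> finj fmeet fact [S ->] SA q Sq v prem.
have f_eval t : f (eval v t) = eval (fun n => f (v n)) t.
  by elim: t => //= [s IHs t IHt|g s IHs]; rewrite ?fmeet ?fact IHs ?IHt.
apply: finj; rewrite !f_eval; apply: SA => //.
by apply: List.Forall_impl prem => e eE; rewrite -!f_eval eE.
Qed.

Lemma Qgen_refl A : Qgen A A.
Proof. by move=> K _. Qed.

Lemma Qgen_satisfies A B q : satisfies A q -> Qgen A B -> satisfies B q.
Proof.
move=> Aq /(_ (models (fun q' => q' = q))) AB; apply: AB => //.
  by exists (fun q' => q' = q).
by move=> _ ->.
Qed.

Definition fix_identity (g : gT) : quasi_identity gT :=
  QuasiIdentity [::] (Act g (Var gT 0), Var gT 0).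

Lemma satisfies_fix_identity A g :
  satisfies A (fix_identity g) <-> forall x : A, gact g x = x.
Proof.
by split=> [Ag x|Ag v _ //=]; exact: (Ag (fun=> x) (List.Forall_nil _)).
Qed.

Lemma mem_gen_stab R g :
  g \in gen_stab R <-> forall A, R A -> forall x : A, gact g x = x.
Proof.
rewrite inE; split=> [/asboolP gx A RA x|gfix].
  move: gx; rewrite /= /free1_gen free_actE => /free_eqP gx.
  exact: (gx A RA (fun=> x)).
apply/asboolP; rewrite /= /free1_gen free_actE; apply/free_eqP => A RA v /=.
exact: gfix.
Qed.

End Quasivarieties.

(** * Meets of translates of an element *)

Section OrbitMeets.
Variables (gT : finGroupType) (A : gslat gT).
Implicit Types (a b c x z o : A) (g h : gT) (S : {set gT}).

Definition gle a b := gmeet a b = a.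

Lemma gle_refl a : gle a a.
Proof. exact: gmeetxx. Qed.

Lemma gle_anti a b : gle a b -> gle b a -> a = b.
Proof. by rewrite /gle gmeetC => -> . Qed.

Lemma gle_trans b a c : gle a b -> gle b c -> gle a c.
Proof. by rewrite /gle => ab bc; rewrite -ab -gmeetA bc. Qed.

Lemma gle_meet a b c : gle a (gmeet b c) <-> gle a b /\ gle a c.
Proof.
rewrite /gle; split=> [abc|[ab ac]]; last by rewrite gmeetA ab ac.
rewrite -abc; split; last by rewrite -!gmeetA gmeetxx.
by rewrite [gmeet b c]gmeetC -!gmeetA gmeetxx.
Qed.

Lemma gactVK g : cancel (@gact _ A g) (gact g^-1).
Proof. by move=> a; rewrite gactM mulVg gact1. Qed.

Lemma gactKV g : cancel (@gact _ A g^-1) (gact g).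
Proof. by move=> a; rewrite gactM mulgV gact1. Qed.

Lemma gle_act g a b : gle (gact g a) b <-> gle a (gact g^-1 b).
Proof.
rewrite /gle -{1}(gactKV g b) gactI.
by split=> [/(can_inj (gactVK g))|->].
Qed.

(** A relation and not a big operator over [S]: a semilattice need not have a
    top element, so the empty meet may not exist. *)
Definition orbit_meet x S b :=
  forall c, gle c b <-> forall g, g \in S -> gle c (gact g x).

Lemma orbit_meet_le x S b g : orbit_meet x S b -> g \in S -> gle b (gact g x).
Proof. by move=> /(_ b) [/(_ (gle_refl b)) + _]; apply. Qed.

Lemma orbit_meet_uniq x S b c : orbit_meet x S b -> orbit_meet x S c -> b = c.
Proof.
by move=> Sb Sc; apply: gle_anti; [apply/Sc/Sb|apply/Sb/Sc]; exact: gle_refl.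
Qed.

Lemma orbit_meet1 x g : orbit_meet x [set g] (gact g x).
Proof. by move=> c; split=> [cx h /set1P -> //|]; apply; rewrite set11. Qed.

Lemma orbit_meetU x S T b c :
  orbit_meet x S b -> orbit_meet x T c -> orbit_meet x (S :|: T) (gmeet b c).
Proof.
move=> Sb Tc d; split=> [/gle_meet [/Sb db /Tc dc] g /setUP [/db|/dc] //|dx].
by apply/gle_meet; split; [apply/Sb|apply/Tc] => g gS; apply: dx;
  rewrite inE gS ?orbT.
Qed.

Lemma orbit_meet_act x S b g :
  orbit_meet x S b -> orbit_meet x (g *: S) (gact g b).
Proof.
move=> Sb c; split=> [|cx].
  rewrite -[g in gact g b]invgK => /gle_act /Sb cx h; rewrite mem_lcoset.
  by move=> /cx /gle_act; rewrite gactM invgK mulKVg.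
rewrite -[g in gact g b]invgK; apply/gle_act/Sb => h hS.
by apply/gle_act; rewrite gactM invgK; apply: cx; rewrite mem_lcoset mulKg.
Qed.

(** A maximal subset with a meet is the whole group, since any translate of [x]
    can be added to it. *)
Lemma orbit_meet_setT x : exists b, orbit_meet x [set: gT] b.
Proof.
pose P S := `[< exists b, orbit_meet x S b >].
have [S /maxsetP [/asboolP [b Sb] Smax]] : {S | maxset P S}.
  by apply: ex_maxset; exists [set 1]; apply/asboolP; exists (gact 1 x);
    exact: orbit_meet1.
suff <- : S = [set: gT] by exists b.
apply/setP => g; rewrite inE.
rewrite -(Smax (S :|: [set g])) ?subsetUl ?inE ?eqxx ?orbT //.
apply/asboolP; exists (gmeet b (gact g x)).
exact: orbit_meetU Sb (orbit_meet1 x g).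
Qed.

Lemma nontrivial_gslat_lt : ~ trivial_gslat A -> exists z x, gle z x /\ z <> x.
Proof.
move=> Anontriv; apply: contrapT => nlt; apply: Anontriv.
have meetE x y : gmeet x y = y.
  by apply: contrapT => xy; apply: nlt; exists (gmeet x y), y;
    rewrite /gle -gmeetA gmeetxx.
have [a] : inhabited A by case: (A).
by exists a => x; rewrite -(meetE a x) gmeetC meetE.
Qed.

(** Maximality of the subset [S] giving [b] is what separates the translates:
    the meet of [b] and [g b] comes from the union of [S] and [g S], so if it
    is not [o] then [g S = S] and [g b = b]. *)
Lemma exists_separated_orbit : ~ trivial_gslat A ->
  exists o b, [/\ forall g, gact g o = o, gle o b, o <> b
    & forall g, gact g b = b \/ gmeet b (gact g b) = o].
Proof.
move=> /nontrivial_gslat_lt [z [x [zx z_neq_x]]].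
have [o oz] := orbit_meet_setT z.
have o_fix g : gact g o = o.
  apply: (@orbit_meet_uniq z [set: gT]) (oz).
  suff <- : g *: [set: gT] = [set: gT] by exact: orbit_meet_act.
  by apply/setP => h; rewrite mem_lcoset !inE.
have ole_z : gle o z by rewrite -(gact1 z); apply: orbit_meet_le oz _.
have ole_x : gle o x by exact: gle_trans ole_z zx.
have o_neq_x : o <> x.
  by move=> ox; apply: z_neq_x; apply: gle_anti zx _; rewrite -ox.
have ole S b : orbit_meet x S b -> gle o b.
  by move=> Sb; apply/Sb => g _; rewrite -(o_fix g); apply/gle_act; rewrite gactVK.
pose P S := `[< exists2 b, orbit_meet x S b & o <> b >].
have [S /maxsetP [/asboolP [b Sb o_neq_b] Smax]] : {S | maxset P S}.
  apply: ex_maxset; exists [set 1]; apply/asboolP; exists x => //.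
  by rewrite -[x in orbit_meet _ _ x]gact1; exact: orbit_meet1.
exists o, b; split=> // [|g]; first exact: ole Sb.
have SgS := orbit_meetU Sb (orbit_meet_act g Sb).
have [<-|o_neq] := EM (o = gmeet b (gact g b)); [by right|left].
apply: (@orbit_meet_uniq x S) (Sb).
suff gS : g *: S = S by rewrite -[S in orbit_meet _ S]gS; exact: orbit_meet_act.
apply/eqP; rewrite eqEcard card_lcoset leqnn andbT.
apply/setUidPl/Smax; last exact: subsetUl.
by apply/asboolP; exists (gmeet b (gact g b)).
Qed.

End OrbitMeets.

(** * Coset semilattices inside nontrivial quasivarieties *)

Section CosetEmbedding.
Variable gT : finGroupType.
Implicit Types g h : gT.

Lemma M_cases (L : {group gT}) (X : M L) :
  val X = set0 \/ exists g, val X = g *: L.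
Proof.
case: X => X /= /orP[/eqP->|/lcosetsP[g _ ->]]; first by left.
by right; exists g.
Qed.

(** The embedding sends the empty set to [o] and [g L] to [g b], where [L] is
    the stabilizer of [b]. *)
Lemma separated_orbit_M (A : gslat gT) (o b : A) :
    (forall g : gT, gact g o = o) -> gle o b -> o <> b ->
    (forall g : gT, gact g b = b \/ gmeet b (gact g b) = o) ->
  exists (L : {group gT}) (f : M L -> A), [/\ injective f,
    forall X Y, f (gmeet X Y) = gmeet (f X) (f Y)
    & forall g X, f (gact g X) = gact g (f X)].
Proof.
move=> o_fix ob o_neq_b sep.
have Lgroup : group_set [set g : gT | `[< gact g b = b >]].
  apply/group_setP; split=> [|g h]; rewrite !inE.
    by apply/asboolP; exact: gact1.
  by move=> /asboolP gb /asboolP hb; apply/asboolP; rewrite -gactM hb.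
pose L := Group Lgroup.
have LP g : reflect (gact g b = b) (g \in L) by rewrite inE; exact: asboolP.
pose f (X : M L) := if val X == set0 then o else gact (repr (val X)) b.
have f0 X : val X = set0 -> f X = o by rewrite /f => ->; rewrite eqxx.
have lcoset_neq0 g : g *: L != set0.
  by apply/set0Pn; exists g; exact: lcoset_refl.
have fL g X : val X = g *: L -> f X = gact g b.
  rewrite /f => ->; rewrite (negPf (lcoset_neq0 g)).
  have : repr (g *: L) \in g *: L by exact: mem_repr (lcoset_refl L g).
  by case/lcosetP => h /LP hb ->; rewrite -gactM hb.
have act_eq g h : gact g b = gact h b -> g *: L = h *: L.
  move=> gh; apply/lcoset_eqP; rewrite mem_lcoset; apply/LP.
  by rewrite -gactM gh gactVK.
have act_neq_o g : gact g b <> o.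
  by move=> gb; apply: o_neq_b; rewrite -(gactVK g b) gb o_fix.
have ole g : gle o (gact g b) by rewrite -(o_fix g); apply/gle_act; rewrite gactVK.
exists L, f; split=> [X Y|X Y|g X].
- have [X0|[g Xg]] := M_cases X; have [Y0|[h Yh]] := M_cases Y.
  + by move=> _; apply: val_inj; rewrite X0 Y0.
  + by rewrite (f0 X X0) (fL h Y Yh) => /esym/act_neq_o.
  + by rewrite (fL g X Xg) (f0 Y Y0) => /act_neq_o.
  + rewrite (fL g X Xg) (fL h Y Yh) => /act_eq gh.
    by apply: val_inj; rewrite Xg Yh.
- have [X0|[g Xg]] := M_cases X; have [Y0|[h Yh]] := M_cases Y.
  + by rewrite !f0 ?gmeetxx //= X0 set0I.
  + by rewrite (fL h Y Yh) !f0 //= ?X0 ?set0I // ole.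
  + by rewrite (fL g X Xg) !f0 //= ?Y0 ?setI0 // gmeetC ole.
  + rewrite (fL g X Xg) (fL h Y Yh).
    have <- : gact g (gmeet b (gact (g^-1 * h) b)) = gmeet (gact g b) (gact h b).
      by rewrite -gactI gactM mulKVg.
    have [gh|gh] := sep (g^-1 * h).
      have ghL : g *: L = h *: L.
        by apply: act_eq; rewrite -{1}gh gactM mulKVg.
      by rewrite gh gmeetxx; apply: fL; rewrite /= Xg Yh ghL setIid.
    rewrite gh o_fix; apply: f0; rewrite /= Xg Yh.
    apply/setP => k; rewrite in_setI in_set0; apply/negP => /andP[].
    rewrite !mem_lcoset => /LP gk /LP hk; apply: (act_neq_o 1); rewrite gact1.
    have ghb : gact (g^-1 * h) b = b.
      by rewrite -{1}hk gactM -mulgA mulKVg.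
    by rewrite -gh ghb gmeetxx.
- have [X0|[h Xh]] := M_cases X.
    rewrite !f0 ?o_fix //= X0.
    by apply/setP => k; rewrite mem_lcoset !inE.
  by rewrite (fL h X Xh) gactM; apply: fL; rewrite /= Xh lcosetM.
Qed.

Lemma nontrivial_quasivariety_M (R : gclass gT) :
  quasivariety R -> ~ trivial_class R -> exists L : {group gT}, R (M L).
Proof.
move=> qR nR.
have [A [RA nA]] : exists A, R A /\ ~ trivial_gslat A.
  apply: contrapT => nex; apply: nR => A RA.
  by apply: contrapT => nA; apply: nex; exists A.
have [o [b [o_fix ob o_neq_b sep]]] := exists_separated_orbit nA.
have [L [f [finj fI fM]]] := separated_orbit_M o_fix ob o_neq_b sep.
by exists L; exact: quasivariety_embedding finj fI fM qR RA.
Qed.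

End CosetEmbedding.

(** * Minimality of the quasivarieties of coset semilattices *)

Section Minimality.
Variables (gT : finGroupType) (abG : abelian [set: gT]).
Implicit Types (H L : {group gT}) (g h : gT).

Definition M_empty H : M H := exist _ set0 (is_M0 H).

Lemma is_M_lcoset1 H : is_M H H.
Proof.
rewrite /is_M; apply/orP; right; apply/lcosetsP; exists 1; rewrite ?inE //.
by rewrite mul1g.
Qed.

Definition M_base H : M H := exist _ (H : {set gT}) (is_M_lcoset1 H).

Lemma M_empty_neq_base H : M_empty H <> M_base H.
Proof.
by move=> /(congr1 val) /= /setP /(_ 1); rewrite group1 inE.
Qed.

Lemma M_act_fix H g (X : M H) : g \in H -> gact g X = X.
Proof.
move=> gH; apply: val_inj => /=.
apply/setP => k; rewrite mem_lcoset.
have [->|[h ->]] := M_cases X; first by rewrite !inE.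
rewrite !mem_lcoset mulgA (centsP abG h^-1 _ g^-1) ?inE // -mulgA.
by rewrite groupMl ?groupV.
Qed.

Lemma M_act_fix_empty H g (X : M H) :
  gact g X = X -> g \notin H -> X = M_empty H.
Proof.
move=> /(congr1 val) /= gX gH; apply: val_inj => /=.
have [//|[h Xh]] := M_cases X; case/negP: gH.
have : g * h \in g *: val X by rewrite mem_lcoset mulKg Xh lcoset_refl.
by rewrite gX Xh mem_lcoset (centsP abG g _ h) ?inE // mulKg.
Qed.

Lemma M_satisfies_fix_identity H g :
  satisfies (M H) (fix_identity g) <-> g \in H.
Proof.
split=> [/satisfies_fix_identity gfix|gH]; last first.
  by apply/satisfies_fix_identity => X; exact: M_act_fix.
apply/negPn/negP => gH; apply: (@M_empty_neq_base H).
by rewrite (M_act_fix_empty (gfix (M_base H)) gH).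
Qed.

(** There is no constant for the least element; the conclusion [x /\ y = x],
    with [y] arbitrary, says that [x] is least. *)
Definition only_fix_least (g : gT) : quasi_identity gT :=
  QuasiIdentity [:: (Act g (Var gT 0), Var gT 0)]
    (Meet (Var gT 0) (Var gT 1%N), Var gT 0).

Lemma M_satisfies_only_fix_least H g :
  satisfies (M H) (only_fix_least g) <-> g \notin H.
Proof.
split=> [sat|gH v /= prem].
  apply/negP => gH; apply: (@M_empty_neq_base H).
  have /= <- := sat (fun n => if n is 0 then M_base H else M_empty H).
    by apply: val_inj; rewrite /= setI0.
  by apply: List.Forall_cons => //=; exact: M_act_fix.
have -> : v 0 = M_empty H.
  by apply: M_act_fix_empty gH; case/List.Forall_cons_iff: prem.
by apply: val_inj; rewrite /= set0I.
Qed.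

(** The identities of [M H] give that [L] contains [H], and its quasi-identities
    [only_fix_least g] that [L] contains no more. *)
Lemma M_in_Qgen H L : Qgen (M H) (M L) -> L = H.
Proof.
move=> HL; apply/val_inj/setP => g /=; apply/idP/idP => [gL|gH].
  apply/negPn/negP => /M_satisfies_only_fix_least /Qgen_satisfies.
  by move=> /(_ _ HL) /M_satisfies_only_fix_least; rewrite gL.
by apply/M_satisfies_fix_identity; apply: Qgen_satisfies HL;
  apply/M_satisfies_fix_identity.
Qed.

Lemma Qgen_M_nontrivial H : ~ trivial_class (Qgen (M H)).
Proof.
move=> /(_ _ (@Qgen_refl _ (M H))) [X X_eq]; apply: (@M_empty_neq_base H).
by rewrite (X_eq (M_empty H)) (X_eq (M_base H)).
Qed.

Lemma Qgen_M_minimal H : minimal_quasivariety (Qgen (M H)).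
Proof.
split=> [||K qK KQ K_neq]; first exact: Qgen_quasivariety.
  exact: Qgen_M_nontrivial.
apply: contrapT => /(nontrivial_quasivariety_M qK) [L KL].
have LH := M_in_Qgen (KQ _ KL); rewrite LH in KL.
by apply: K_neq; apply/funext => B; apply/propext; split=> [/KQ //|]; apply.
Qed.

Lemma minimal_quasivariety_Qgen_M (R : gclass gT) :
  minimal_quasivariety R -> exists L, R = Qgen (M L).
Proof.
move=> [qR nR Rmin]; have [L RL] := nontrivial_quasivariety_M qR nR.
exists L; apply: contrapT => R_neq; apply: (@Qgen_M_nontrivial L).
apply: Rmin => [|B|/esym //]; first exact: Qgen_quasivariety.
by apply.
Qed.

Lemma gen_stab_Qgen_M H : gen_stab (Qgen (M H)) = H.
Proof.
apply/setP => g; apply/idP/idP => [/mem_gen_stab gfix|gH].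
  apply/M_satisfies_fix_identity/satisfies_fix_identity.
  exact: gfix (@Qgen_refl _ (M H)).
apply/mem_gen_stab => A QA; apply/satisfies_fix_identity.
by apply: Qgen_satisfies QA; apply/M_satisfies_fix_identity.
Qed.

End Minimality.

Theorem theorem6p1 (gT : finGroupType) (abG : abelian [set: gT]) :
  bijective (@alpha gT) /\
  exists beta : {group gT} -> MinQVar gT,
    [/\ cancel (@alpha gT) beta, cancel beta (@alpha gT)
      & forall H : {group gT}, sval (beta H) = Qgen (M H)].
Proof.
pose beta (H : {group gT}) : MinQVar gT := exist _ _ (Qgen_M_minimal abG H).
have betaK : cancel beta (@alpha gT).
  by move=> H; apply: val_inj; exact: (gen_stab_Qgen_M abG H).
have alphaK : cancel (@alpha gT) beta.
  move=> [R Rmin]; have [L RL] := minimal_quasivariety_Qgen_M Rmin.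
  have -> : exist _ R Rmin = beta L by exact: eq_exist.
  by rewrite betaK.
by split; [exists beta | exists beta].
Qed.
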